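(* A Schauder decomposition in a Hilbert space is normal if and only if it is a Schauder-Orlicz decomposition with the Orlicz function $t^2$.
   Context: A Schauder decomposition of a Banach space $X$ is a sequence $\{\mathfrak{M}_n\}_{n=0}^{\infty}$ of closed nonzero linear subspaces of $X$ such that each $x\in X$ has a unique norm convergent expansion $x=\sum_{n=0}^{\infty}x_n$ with $x_n\in\mathfrak{M}_n$ for all $n$. Its associated sequence of coordinate projections (a.s.c.p.) $\{P_n\}_{n=0}^{\infty}$ is defined by $P_nx=x_n$; each $P_n$ is bounded. The decomposition is normal if $\|P_n\|=1$ for all $n$. For an Orlicz function $\Phi$ (a continuous, nondecreasing, convex function $\Phi:[0,\infty)\to[0,\infty)$ with $\Phi(0)=0$, $\lim_{t\to\infty}\Phi(t)=\infty$), a Schauder decomposition of $X$ with a.s.c.p. $\{P_n\}$ is a Schauder-Orlicz decomposition with Orlicz function $\Phi$ if for every $x\in X$: $\inf\{\rho>0:\sum_{n=0}^{\infty}\Phi(\|P_nx\|/\rho)\le 1\}=\|x\|$. *)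

(* Defs.v *)
(* Stdlib reals with Coquelicot. *)
From Stdlib Require Import Reals.
From Coquelicot Require Import Coquelicot.

Open Scope R_scope.

Inductive scalars : Set := Real | Complex.

Definition scalar_field (k : scalars) : AbsRing :=
  match k with Real => R_AbsRing | Complex => C_AbsRing end.

Definition scalar_conj (k : scalars) : scalar_field k -> scalar_field k :=
  match k with Real => fun a : R => a | Complex => Cconj end.

Definition scalar_of_R (k : scalars) : R -> scalar_field k :=
  match k with Real => fun r : R => r | Complex => RtoC end.

Definition BanachSpace (k : scalars) : Type :=
  CompleteNormedModule (scalar_field k).

(* Positive definiteness of the inner product follows from [inner_norm],
   since the norm of a normed module vanishes only at zero. *)
Record HilbertSpace (k : scalars) : Type := {
  hilbert_space :> CompleteNormedModule (scalar_field k);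
  inner : hilbert_space -> hilbert_space -> scalar_field k;
  inner_plus_l : forall x y z : hilbert_space,
    inner (plus x y) z = plus (inner x z) (inner y z);
  inner_scal_l : forall (a : scalar_field k) (x y : hilbert_space),
    inner (scal a x) y = mult a (inner x y);
  inner_conj : forall x y : hilbert_space,
    inner y x = scalar_conj k (inner x y);
  inner_norm : forall x : hilbert_space,
    inner x x = scalar_of_R k (norm x ^ 2)
}.

Definition linear_subspace {k : scalars} {X : BanachSpace k}
    (M : X -> Prop) : Prop :=
  M zero /\
  (forall x y : X, M x -> M y -> M (plus x y)) /\
  (forall (a : scalar_field k) (x : X), M x -> M (scal a x)).

Definition expansion {k : scalars} {X : BanachSpace k}
    (M : nat -> X -> Prop) (x : X) (xs : nat -> X) : Prop :=
  (forall n, M n (xs n)) /\ is_series xs x.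

Definition schauder_decomposition {k : scalars} {X : BanachSpace k}
    (M : nat -> X -> Prop) : Prop :=
  (forall n, linear_subspace (M n) /\ closed (M n) /\
             exists x : X, M n x /\ x <> zero) /\
  (forall x : X, exists xs : nat -> X, expansion M x xs /\
     forall ys : nat -> X, expansion M x ys -> forall n, ys n = xs n).

(* The coordinate projections of a Schauder decomposition are determined by
   this relation, because expansions are unique. *)
Definition coordinate_projections {k : scalars} {X : BanachSpace k}
    (M : nat -> X -> Prop) (P : nat -> X -> X) : Prop :=
  forall x : X, expansion M x (fun n => P n x).

(* Equal to [p_infty] when [T] is unbounded. *)
Definition operator_norm {k : scalars} {X : BanachSpace k}
    (T : X -> X) : Rbar :=
  Lub_Rbar (fun r : R => exists x : X, norm x <= 1 /\ r = norm (T x)).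

Definition normal_decomposition {k : scalars} {X : BanachSpace k}
    (M : nat -> X -> Prop) : Prop :=
  schauder_decomposition M /\
  exists P : nat -> X -> X, coordinate_projections M P /\
    forall n, operator_norm (P n) = Finite 1.

(* Only the restriction of [Phi] to the half-line [0 <= t] is relevant. *)
Definition orlicz_function (Phi : R -> R) : Prop :=
  (forall t, 0 <= t -> 0 <= Phi t) /\
  (forall t, 0 <= t ->
     filterlim Phi (within (fun s => 0 <= s) (locally t)) (locally (Phi t))) /\
  (forall s t, 0 <= s -> s <= t -> Phi s <= Phi t) /\
  (forall s t a, 0 <= s -> 0 <= t -> 0 <= a <= 1 ->
     Phi (a * s + (1 - a) * t) <= a * Phi s + (1 - a) * Phi t) /\
  Phi 0 = 0 /\
  is_lim Phi p_infty p_infty.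

Definition schauder_orlicz_decomposition {k : scalars} {X : BanachSpace k}
    (M : nat -> X -> Prop) (Phi : R -> R) : Prop :=
  schauder_decomposition M /\ orlicz_function Phi /\
  exists P : nat -> X -> X, coordinate_projections M P /\
    forall x : X,
      Glb_Rbar (fun rho : R => 0 < rho /\
        exists s : R, is_series (fun n => Phi (norm (P n x) / rho)) s /\ s <= 1)
      = Finite (norm x).

(* Main.v *)
Require Import Defs.
From Stdlib Require Import Reals.
From Coquelicot Require Import Coquelicot.
From Stdlib Require Import Lra Lia.
Open Scope R_scope.

(** Both properties say that the coordinate projections are contractions which
    add up to the identity orthogonally.

    If [P n] has norm one, then for [u] in [M n] and [v] in [M m] with
    [m <> n], the vector [u] is the [n]-th coordinate of [u + t v] for every
    real [t], so [norm u <= norm (u + t v)].  In a Hilbert space a vector which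
    is shortest on the line through it in direction [v] is orthogonal to [v]
    ([shortest_on_line_orthogonal]).  Hence the subspaces are pairwise
    orthogonal and Pythagoras, passed to the limit, gives
    [norm x ^ 2 = sum_n norm (P n x) ^ 2] ([pythagoras_series]).  With this
    identity the modular [sum_n (norm (P n x) / rho) ^ 2] equals
    [(norm x / rho) ^ 2], which is at most one exactly when [norm x <= rho]; the
    infimum of these [rho] is [norm x].

    Conversely, a single term of a series of squares is at most its sum, so the
    Luxemburg formula gives [norm (P n x) <= norm x].  A contractive projection
    with nonzero range has norm one, as it fixes a unit vector of its range
    ([operator_norm_contraction]).

    The argument takes place in the underlying real Hilbert space.  Real and
    complex scalars are therefore treated at once, through the real scaling
    [rscal] and the real inner product [ip]. *)

(** * Real structure of a space over either scalar field *)

Definition rscal {k : scalars} {X : BanachSpace k} (r : R) (x : X) : X :=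
  scal (scalar_of_R k r) x.

Definition scalar_re (k : scalars) : scalar_field k -> R :=
  match k with Real => fun a : R => a | Complex => fst end.

Definition ip {k : scalars} {H : HilbertSpace k} (x y : H) : R :=
  scalar_re k (inner k H x y).

Lemma norm_rscal_le {k : scalars} {X : BanachSpace k} (r : R) (x : X) :
  norm (rscal r x) <= Rabs r * norm x.
Proof.
  unfold rscal.
  replace (Rabs r) with (abs (scalar_of_R k r)).
  - apply (norm_scal (scalar_of_R k r) x).
  - destruct k.
    + reflexivity.
    + apply Cmod_R.
Qed.

Lemma rscal_inv {k : scalars} {X : BanachSpace k} (r : R) (x : X) :
  r <> 0 -> rscal r (rscal (/ r) x) = x.
Proof.
  intros Hr. unfold rscal. rewrite scal_assoc.
  replace (mult (scalar_of_R k r) (scalar_of_R k (/ r)))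
    with (one : scalar_field k).
  - apply scal_one.
  - destruct k.
    + change (1 = r * / r). field. exact Hr.
    + change (RtoC 1 = Cmult (RtoC r) (RtoC (/ r))).
      rewrite <- RtoC_mult. f_equal. field. exact Hr.
Qed.

(** Scaling by [r] and by [/ r] are each submultiplicative, which together
    forces equality. *)
Lemma norm_rscal_inv {k : scalars} {X : BanachSpace k} (r : R) (x : X) :
  0 < r -> norm (rscal (/ r) x) = norm x / r.
Proof.
  intros Hr.
  assert (Hr' : 0 < / r) by now apply Rinv_0_lt_compat.
  apply Rle_antisym.
  - eapply Rle_trans; [apply norm_rscal_le |].
    rewrite Rabs_pos_eq by lra. unfold Rdiv. lra.
  - apply Rmult_le_reg_l with r; [exact Hr |].
    replace (r * (norm x / r)) with (norm x) by (field; lra).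
    pose proof (norm_rscal_le r (rscal (/ r) x)) as Hle.
    rewrite rscal_inv, Rabs_pos_eq in Hle by lra. exact Hle.
Qed.

Lemma norm_pos {k : scalars} {X : BanachSpace k} (x : X) :
  x <> zero -> 0 < norm x.
Proof.
  intros Hx. destruct (norm_ge_0 x) as [Hlt | Heq]; [exact Hlt |].
  destruct Hx. exact (norm_eq_zero (V := X) x (eq_sym Heq)).
Qed.

Lemma ip_plus_l {k : scalars} {H : HilbertSpace k} (x y z : H) :
  ip (plus x y) z = ip x z + ip y z.
Proof.
  unfold ip. rewrite inner_plus_l. now destruct k.
Qed.

Lemma ip_sym {k : scalars} {H : HilbertSpace k} (x y : H) : ip y x = ip x y.
Proof.
  unfold ip. rewrite (inner_conj k H x y). now destruct k.
Qed.

Lemma ip_plus_r {k : scalars} {H : HilbertSpace k} (x y z : H) :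
  ip x (plus y z) = ip x y + ip x z.
Proof.
  now rewrite ip_sym, ip_plus_l, (ip_sym x y), (ip_sym x z).
Qed.

Lemma ip_rscal_l {k : scalars} {H : HilbertSpace k} (r : R) (x y : H) :
  ip (rscal r x) y = r * ip x y.
Proof.
  unfold ip, rscal. rewrite inner_scal_l. destruct k.
  - reflexivity.
  - simpl. ring.
Qed.

Lemma ip_norm {k : scalars} {H : HilbertSpace k} (x : H) :
  ip x x = norm x ^ 2.
Proof.
  unfold ip. rewrite inner_norm. now destruct k.
Qed.

Lemma norm_plus_sq {k : scalars} {H : HilbertSpace k} (x y : H) :
  norm (plus x y) ^ 2 = norm x ^ 2 + 2 * ip x y + norm y ^ 2.
Proof.
  rewrite <- !ip_norm, ip_plus_l, !ip_plus_r, (ip_sym x y). ring.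
Qed.

(** * Orthogonality and Pythagoras *)

(** The function [t => norm (u + t v) ^ 2] is a quadratic polynomial with linear
    coefficient [2 * ip u v], minimal at [t = 0]. *)
Lemma shortest_on_line_orthogonal {k : scalars} {H : HilbertSpace k}
    (u v : H) :
  (forall t : R, norm u <= norm (plus u (rscal t v))) -> ip u v = 0.
Proof.
  intros Hmin.
  set (c := ip u v). set (d := norm v ^ 2).
  assert (Hd : 0 <= d) by apply pow2_ge_0.
  assert (Hq : forall t, 0 <= 2 * t * c + t ^ 2 * d).
  { intros t.
    assert (Hsq : norm u ^ 2 <= norm (plus u (rscal t v)) ^ 2).
    { apply pow_incr. split; [apply norm_ge_0 | apply Hmin]. }
    rewrite norm_plus_sq, <- (ip_norm (rscal t v)) in Hsq.
    rewrite (ip_sym (rscal t v) u), ip_rscal_l in Hsq.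
    rewrite ip_rscal_l, (ip_sym (rscal t v) v), ip_rscal_l in Hsq.
    rewrite ip_norm, (ip_sym u v) in Hsq.
    fold c d in Hsq. nra. }
  (* The minimiser is [- c / d]; the shift by one avoids dividing by zero. *)
  specialize (Hq (- c / (d + 1))).
  replace (2 * (- c / (d + 1)) * c + (- c / (d + 1)) ^ 2 * d)
    with (- ((c / (d + 1)) ^ 2 * (d + 2))) in Hq by (field; lra).
  assert (Hz : c / (d + 1) = 0).
  { pose proof (pow2_ge_0 (c / (d + 1))). nra. }
  replace c with (c / (d + 1) * (d + 1)) by (field; lra).
  rewrite Hz. ring.
Qed.

Lemma ip_sum_n {k : scalars} {H : HilbertSpace k} (xs : nat -> H) (y : H)
    (n : nat) :
  (forall i, (i <= n)%nat -> ip (xs i) y = 0) -> ip (sum_n xs n) y = 0.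
Proof.
  induction n as [| n IH]; intros Hxs.
  - rewrite sum_O. now apply Hxs.
  - rewrite sum_Sn, ip_plus_l, IH, Hxs; auto; lra.
Qed.

Lemma pythagoras_sum_n {k : scalars} {H : HilbertSpace k} (xs : nat -> H)
    (n : nat) :
  (forall i j, i <> j -> ip (xs i) (xs j) = 0) ->
  norm (sum_n xs n) ^ 2 = sum_n (fun i => norm (xs i) ^ 2) n.
Proof.
  intros Hort. induction n as [| n IH].
  - now rewrite !sum_O.
  - rewrite !sum_Sn, norm_plus_sq, IH, ip_sum_n.
    + change (@plus R_AbelianMonoid) with Rplus. ring.
    + intros i Hi. apply Hort. lia.
Qed.

Lemma pythagoras_series {k : scalars} {H : HilbertSpace k} (xs : nat -> H)
    (x : H) :
  (forall i j, i <> j -> ip (xs i) (xs j) = 0) -> is_series xs x ->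
  is_series (fun n => norm (xs n) ^ 2) (norm x ^ 2).
Proof.
  intros Hort Hx.
  apply (is_lim_seq_ext (fun n => norm (sum_n xs n) ^ 2)
           (sum_n (fun i => norm (xs i) ^ 2)) (norm x ^ 2)).
  - intros n. now apply pythagoras_sum_n.
  - assert (Hn : is_lim_seq (fun n => norm (sum_n xs n)) (norm x)).
    { apply (filterlim_comp _ _ _ (sum_n xs) norm _ (locally x)).
      - exact Hx.
      - exact (filterlim_norm (V := H) x). }
    simpl. apply is_lim_seq_mult'; [exact Hn |].
    apply is_lim_seq_mult'; [exact Hn | apply is_lim_seq_const].
Qed.

(** * Coordinates in a Schauder decomposition *)

Definition single {k : scalars} {X : BanachSpace k} (n : nat) (u : X) (j : nat)
  : X := if Nat.eq_dec j n then u else zero.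

Lemma is_series_single {k : scalars} {X : BanachSpace k} (n : nat) (u : X) :
  is_series (single n u) u.
Proof.
  assert (Hsmall : forall m, (m < n)%nat -> sum_n (single n u) m = zero).
  { induction m as [| m IH]; intros Hm.
    - rewrite sum_O. unfold single. destruct Nat.eq_dec; [lia | reflexivity].
    - rewrite sum_Sn, IH by lia. unfold single.
      destruct Nat.eq_dec; [lia | apply plus_zero_l]. }
  assert (Hlarge : forall m, sum_n (single n u) (n + m) = u).
  { induction m as [| m IH].
    - rewrite Nat.add_0_r. destruct n as [| n].
      + now rewrite sum_O.
      + rewrite sum_Sn, Hsmall by lia. unfold single.
        destruct Nat.eq_dec; [apply plus_zero_l | lia].
    - rewrite Nat.add_succ_r, sum_Sn, IH. unfold single.
      destruct Nat.eq_dec; [lia | apply plus_zero_r]. }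
  apply (filterlim_ext_loc (fun _ => u)); [| apply filterlim_const].
  exists n. intros m Hm. symmetry.
  replace m with (n + (m - n))%nat by lia. apply Hlarge.
Qed.

Section Coordinates.

Context {k : scalars} {X : BanachSpace k}.
Context {M : nat -> X -> Prop} {P : nat -> X -> X}.
Context (hM : schauder_decomposition M) (hP : coordinate_projections M P).

Lemma subspace_zero (n : nat) : M n zero.
Proof. now destruct (proj1 hM n) as [[H0 _] _]. Qed.

Lemma subspace_plus (n : nat) (x y : X) : M n x -> M n y -> M n (plus x y).
Proof. destruct (proj1 hM n) as [[_ [Hp _]] _]. apply Hp. Qed.

Lemma subspace_rscal (n : nat) (r : R) (x : X) : M n x -> M n (rscal r x).
Proof. destruct (proj1 hM n) as [[_ [_ Hs]] _]. apply Hs. Qed.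

Lemma coordinate_unique (x : X) (ys : nat -> X) :
  expansion M x ys -> forall n, P n x = ys n.
Proof.
  intros Hys n. destruct (proj2 hM x) as [xs [_ Huniq]].
  now rewrite (Huniq _ Hys n), (Huniq _ (hP x) n).
Qed.

Lemma expansion_single (n : nat) (u : X) : M n u -> expansion M u (single n u).
Proof.
  intros Hu. split.
  - intros j. unfold single. destruct Nat.eq_dec as [-> |].
    + exact Hu.
    + apply subspace_zero.
  - apply is_series_single.
Qed.

Lemma expansion_plus (x y : X) (xs ys : nat -> X) :
  expansion M x xs -> expansion M y ys ->
  expansion M (plus x y) (fun n => plus (xs n) (ys n)).
Proof.
  intros [Hx Sx] [Hy Sy]. split.
  - intros n. now apply subspace_plus.
  - now apply (is_series_plus xs ys).
Qed.

Lemma expansion_rscal (r : R) (x : X) (xs : nat -> X) :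
  expansion M x xs -> expansion M (rscal r x) (fun n => rscal r (xs n)).
Proof.
  intros [Hx Sx]. split.
  - intros n. now apply subspace_rscal.
  - now apply (is_series_scal (scalar_of_R k r) xs).
Qed.

Lemma coordinate_fixes (n : nat) (u : X) : M n u -> P n u = u.
Proof.
  intros Hu. rewrite (coordinate_unique _ _ (expansion_single n u Hu)).
  unfold single. now destruct Nat.eq_dec.
Qed.

Lemma coordinate_rscal (n : nat) (r : R) (x : X) :
  P n (rscal r x) = rscal r (P n x).
Proof.
  now rewrite (coordinate_unique _ _ (expansion_rscal r x _ (hP x))).
Qed.

(** The one-term expansions of [u] and of [rscal t v] add up to the expansion of
    the sum. *)
Lemma coordinate_on_line (n m : nat) (u v : X) (t : R) :
  n <> m -> M n u -> M m v -> P n (plus u (rscal t v)) = u.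
Proof.
  intros Hnm Hu Hv.
  assert (Htv : M m (rscal t v)) by now apply subspace_rscal.
  rewrite (coordinate_unique _ _ (expansion_plus _ _ _ _
             (expansion_single n u Hu) (expansion_single m _ Htv))).
  unfold single. destruct (Nat.eq_dec n n); [| easy].
  destruct (Nat.eq_dec n m); [easy | apply plus_zero_r].
Qed.

(** The operator norm only controls the unit ball; homogeneity extends the
    bound to the whole space. *)
Lemma norm_le_of_operator_norm (n : nat) (x : X) :
  operator_norm (P n) = Finite 1 -> norm (P n x) <= norm x.
Proof.
  intros Hn.
  assert (Hball : forall y : X, norm y <= 1 -> norm (P n y) <= 1).
  { intros y Hy.
    assert (Hub : Rbar_le (norm (P n y)) (operator_norm (P n))).
    { apply (proj1 (Lub_Rbar_correct _)). now exists y. }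
    rewrite Hn in Hub. exact Hub. }
  destruct (norm_ge_0 x) as [Hx | Hx].
  - specialize (Hball (rscal (/ norm x) x)).
    rewrite coordinate_rscal, !norm_rscal_inv in Hball by exact Hx.
    apply Rmult_le_reg_r with (/ norm x); [now apply Rinv_0_lt_compat |].
    rewrite Rinv_r by lra. apply Hball. right. field. lra.
  - apply eq_sym, (norm_eq_zero (V := X)) in Hx. subst x.
    rewrite coordinate_fixes; [apply Rle_refl | apply subspace_zero].
Qed.

(** The supremum is attained at a normalised nonzero vector of [M n]. *)
Lemma operator_norm_contraction (n : nat) :
  (forall x, norm (P n x) <= norm x) -> operator_norm (P n) = Finite 1.
Proof.
  intros Hc. apply is_lub_Rbar_unique. split.
  - intros r (x & Hx & ->). simpl. specialize (Hc x). lra.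
  - intros b Hb. apply Hb.
    destruct (proj1 hM n) as [_ [_ (u & Hu & Hu0)]].
    apply norm_pos in Hu0.
    assert (H1 : norm (rscal (/ norm u) u) = 1).
    { rewrite norm_rscal_inv by exact Hu0. field. lra. }
    exists (rscal (/ norm u) u).
    rewrite coordinate_rscal, coordinate_fixes by exact Hu. lra.
Qed.

End Coordinates.

(** * The Luxemburg norm of the square function *)

Lemma orlicz_function_sq : orlicz_function (fun t : R => t ^ 2).
Proof.
  refine (conj _ (conj _ (conj _ (conj _ (conj _ _))))).
  - intros t _. apply pow2_ge_0.
  - intros t _. eapply filterlim_filter_le_1; [apply filter_le_within |].
    apply (ex_derive_continuous (fun t : R => t ^ 2)). auto_derive. exact I.
  - intros s t Hs Hst. now apply pow_incr.
  - intros s t a _ _ Ha.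
    (* The gap in the convexity inequality is [a * (1 - a) * (s - t) ^ 2]. *)
    pose proof (pow2_ge_0 (s - t)).
    assert (0 <= a * (1 - a)) by nra. nra.
  - ring.
  - apply (is_lim_le_p_loc (fun t => t)); [| apply is_lim_id].
    exists 1. intros t Ht. nra.
Qed.

Lemma is_series_div_sq (a : nat -> R) (s rho : R) :
  0 < rho -> is_series (fun n => a n ^ 2) s ->
  is_series (fun n => (a n / rho) ^ 2) (s / rho ^ 2).
Proof.
  intros Hrho Ha.
  replace (s / rho ^ 2) with (/ rho ^ 2 * s) by (field; lra).
  apply (is_series_ext (fun n => / rho ^ 2 * a n ^ 2)).
  - intros n. change (/ rho ^ 2 * a n ^ 2 = (a n / rho) ^ 2 :> R).
    field. lra.
  - exact (is_series_scal (V := R_NormedModule) (/ rho ^ 2) _ _ Ha).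
Qed.

(** A finite modular is [(N / rho) ^ 2], so the admissible [rho] form the
    half-line from [N] on, with [0] removed when [N = 0]. *)
Lemma luxemburg_sq (a : nat -> R) (N : R) :
  0 <= N -> is_series (fun n => a n ^ 2) (N ^ 2) ->
  Glb_Rbar (fun rho : R => 0 < rho /\
    exists s : R, is_series (fun n => (a n / rho) ^ 2) s /\ s <= 1)
  = Finite N.
Proof.
  intros HN Ha.
  assert (Hadm : forall rho, 0 < rho -> N <= rho ->
    exists s : R, is_series (fun n => (a n / rho) ^ 2) s /\ s <= 1).
  { intros rho Hrho Hle. exists (N ^ 2 / rho ^ 2).
    split; [now apply is_series_div_sq |].
    apply Rmult_le_reg_r with (rho ^ 2); [now apply pow_lt |].
    replace (N ^ 2 / rho ^ 2 * rho ^ 2) with (N ^ 2) by (field; lra).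
    rewrite Rmult_1_l. now apply pow_incr. }
  apply is_glb_Rbar_unique. split.
  - intros rho (Hrho & s & Hs & Hs1). simpl.
    pose proof (is_series_div_sq _ _ _ Hrho Ha) as Hs'.
    apply is_series_unique in Hs, Hs'. rewrite Hs in Hs'. subst s.
    rewrite Hs' in Hs1.
    apply Rmult_le_compat_r with (r := rho ^ 2) in Hs1; [| apply pow2_ge_0].
    replace (N ^ 2 / rho ^ 2 * rho ^ 2) with (N ^ 2) in Hs1 by (field; lra).
    nra.
  - intros b Hb.
    assert (Hlb : forall e, 0 < e -> Rbar_le b (N + e)).
    { intros e He. apply Hb. split; [lra | apply Hadm; lra]. }
    destruct b as [b | |]; simpl in *.
    + apply Rle_plus_epsilon. exact Hlb.
    + exact (Hlb 1 Rlt_0_1).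
    + exact I.
Qed.

Lemma is_series_pos_term_le (a : nat -> R) (s : R) (n : nat) :
  (forall i, 0 <= a i) -> is_series a s -> a n <= s.
Proof.
  intros Ha Hs.
  apply Rle_trans with (sum_n a n).
  - destruct n as [| n].
    + rewrite sum_O. apply Rle_refl.
    + rewrite sum_Sn. change (@plus R_AbelianMonoid) with Rplus.
      assert (0 <= sum_n a n); [| simpl; lra].
      induction n as [| n IH].
      * now rewrite sum_O.
      * rewrite sum_Sn. apply Rplus_le_le_0_compat; auto.
  - apply (is_lim_seq_incr_compare (sum_n a) s Hs).
    intros m. rewrite sum_Sn. change (@plus R_AbelianMonoid) with Rplus.
    specialize (Ha (S m)). simpl. lra.
Qed.

Lemma luxemburg_sq_term_le (a : nat -> R) (N : R) (n : nat) :
  Glb_Rbar (fun rho : R => 0 < rho /\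
    exists s : R, is_series (fun n => (a n / rho) ^ 2) s /\ s <= 1)
  = Finite N ->
  a n <= N.
Proof.
  intros Hglb.
  assert (Hle : Rbar_le (a n) N); [| exact Hle].
  rewrite <- Hglb. apply (proj2 (Glb_Rbar_correct _)).
  intros rho (Hrho & s & Hs & Hs1). simpl.
  pose proof (is_series_pos_term_le _ _ n (fun i => pow2_ge_0 _) Hs) as Hn.
  simpl in Hn.
  assert (Hn1 : a n / rho <= 1) by nra.
  apply Rmult_le_compat_r with (r := rho) in Hn1; [| lra].
  replace (a n / rho * rho) with (a n) in Hn1 by (field; lra).
  lra.
Qed.

(** * Normal decompositions of a Hilbert space *)

Theorem theorem26 (k : scalars) (H : HilbertSpace k) (M : nat -> H -> Prop)
    (hM : schauder_decomposition M) :
  normal_decomposition M <->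
  schauder_orlicz_decomposition M (fun t : R => t ^ 2).
Proof.
  split.
  - intros [_ (P & hP & Hnorm)].
    split; [exact hM | split; [exact orlicz_function_sq |]].
    exists P. split; [exact hP |]. intros x.
    apply luxemburg_sq; [apply norm_ge_0 |].
    apply pythagoras_series; [| apply (hP x)].
    intros i j Hij. apply shortest_on_line_orthogonal. intros t.
    pose proof (norm_le_of_operator_norm hM hP i
                  (plus (P i x) (rscal t (P j x))) (Hnorm i)) as Hle.
    rewrite (coordinate_on_line hM hP i j) in Hle;
      [exact Hle | exact Hij | apply (hP x) | apply (hP x)].
  - intros [_ [_ (P & hP & Hlux)]].
    split; [exact hM |]. exists P. split; [exact hP |]. intros n.
    apply (operator_norm_contraction hM hP). intros x.
    exact (luxemburg_sq_term_le (fun i => norm (P i x)) _ n (Hlux x)).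
Qed.
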